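(* Let $G$ be a finite simple graph with $n$ vertices and $m$ edges, where $n\geq 3$. Let $n_i$ be the number of vertices of neighborhood degree $i$, and let $\delta$ and $\Delta$ be the minimum and maximum neighborhood degree of $G$. Let $M_1=\sum_{u\in V(G)}d(u)^2$. Assume $\Delta-\delta\geq 2$ and $M_1-n\delta=q(\Delta-\delta)+r$, where $q$ is a positive integer and $r$ is an integer with $0\leq r\leq\Delta-\delta-1$. Let $\alpha\in\mathbb{R}$ with $\alpha\notin\{0,1\}$; when $\alpha<0$ assume moreover that $\delta\geq1$ (equivalently, $G$ has no isolated vertices). Put $s_\alpha=\frac{\Delta^\alpha-\delta^\alpha}{\Delta-\delta}$. Then: \begin{enumerate} \item If $r=0$ and $n_\Delta=q$, then every vertex of $G$ has neighborhood degree $\delta$ or $\Delta$. \item If $r\geq1$ and $n_\Delta=q$, then $n_i=0$ for $\delta+r+1\leq i\leq\Delta-1$ and $n_{\delta+r}\leq 1$. \item If $r\geq 1$, ($\alpha<0$ or $\alpha>1$), and $n_{\delta+r}\neq0$, then $NM_\alpha(G)\leq n\delta^\alpha+(M_1-n\delta)s_\alpha+(\delta+r)^\alpha-\delta^\alpha-r s_\alpha$. \item If $r\geq1$, $0<\alpha<1$, and $n_{\delta+r}\neq 0$, then $NM_\alpha(G)\geq n\delta^\alpha+(M_1-n\delta)s_\alpha+(\delta+r)^\alpha-\delta^\alpha-r s_\alpha$. \end{enumerate} In parts (3) and (4), equality holds if $G$ has exactly $q$ vertices of neighborhood degree $\Delta$, exactly one vertex of neighborhood degree $\delta+r$, and $n-q-1$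 vertices of neighborhood degree $\delta$.
   Context: For a vertex $u$ of a graph $G$, $d(u)$ denotes its degree and the neighborhood degree $\delta_G(u)$ is the sum of the degrees of the vertices adjacent to $u$. The first Zagreb index is $M_1(G)=\sum_{u\in V(G)}d(u)^2$. For a real number $\alpha\notin\{0,1\}$, the general neighborhood Zagreb index is $NM_\alpha(G)=\sum_{u\in V(G)}\delta_G(u)^\alpha$. *)

(* Defs.v *)
From HB Require Import structures.
From mathcomp Require Import all_boot all_order all_algebra.
From mathcomp Require Import reals exp.

Set Implicit Arguments.
Unset Strict Implicit.
Unset Printing Implicit Defensive.

Import Order.TTheory GRing.Theory Num.Theory.

Record sgraph := SGraph {
  vertex :> finType;
  adj : rel vertex;
  adj_sym : symmetric adj;
  adj_irr : irreflexive adj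
}.

Arguments adj {s} : rename.

Section NeighborhoodDegree.

Variable G : sgraph.
Implicit Types (u v : G) (i : nat).

Definition edges : {set {set G}} :=
  [set A : {set G} | [exists u, exists v, adj u v && (A == [set u; v])]].

Definition deg u : nat := #|[set v | adj u v]|.

Definition ndeg u : nat := \sum_(v | adj u v) deg v.

Definition max_ndeg : nat := \max_(u : G) ndeg u.

(* The default value [max_ndeg] does not affect the minimum when the graph has
   a vertex: see [min_ndeg_le] and [min_ndeg_attained]. *)
Definition min_ndeg : nat := \big[minn/max_ndeg]_(u : G) ndeg u.

Definition num_ndeg i : nat := #|[set u | ndeg u == i]|.

Definition first_Zagreb : nat := \sum_(u : G) deg u ^ 2.

(* [powR] satisfies [0 `^ a = 0] for every [a != 0], negative [a] included, so
   statements with [a < 0] must exclude neighborhood degree 0. *)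
Definition gen_nbhd_Zagreb (R : realType) (a : R) : R :=
  (\sum_(u : G) (ndeg u)%:R `^ a)%R.

Lemma max_ndeg_ge u : ndeg u <= max_ndeg.
Proof. exact: (@leq_bigmax G ndeg u). Qed.

Lemma max_ndeg_attained : 0 < #|G| -> exists u, ndeg u = max_ndeg.
Proof. by rewrite /max_ndeg => G0; have [u ->] := bigop.eq_bigmax ndeg G0; exists u. Qed.

Lemma min_ndeg_le u : min_ndeg <= ndeg u.
Proof.
rewrite /min_ndeg; elim: (index_enum _) (mem_index_enum u) => // v s IHs.
rewrite inE big_cons geq_min => /predU1P[-> | /IHs ->]; last exact: orbT.
by rewrite leqnn.
Qed.

Lemma min_ndeg_attained : 0 < #|G| -> exists u, ndeg u = min_ndeg.
Proof.
move=> G0; rewrite /min_ndeg.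
elim/big_ind: _ => [|x y [u ux] [v vy]|u _]; first exact: max_ndeg_attained.
  by case: (leqP x y) => _; [exists u | exists v].
by exists u.
Qed.

End NeighborhoodDegree.

(* Main.v *)
Require Import Defs.
From HB Require Import structures.
From mathcomp Require Import all_boot all_order all_algebra.
From mathcomp Require Import classical_sets set_interval normedtype.
From mathcomp Require Import interval_inference reals convex exp hoelder.
From mathcomp Require Import zify ring.

Set Implicit Arguments.
Unset Strict Implicit.
Unset Printing Implicit Defensive.

Import Order.TTheory GRing.Theory Num.Theory.
Import numFieldNormedType.Exports.
Local Open Scope ring_scope.

(** Double counting gives [\sum_u ndeg u = M1], so the excesses [ndeg u - delta]
    add up to [q (Delta - delta) + r].  If [q] vertices have neighborhood degree
    [Delta], the excesses of the others add up to [r], which gives (1) and (2).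
    For (3) and (4), compare [x `^ alpha] with its chord over [delta, Delta] at
    every vertex except one of neighborhood degree [delta + r], whose
    contribution is kept exactly; summing the chord values needs only [M1].
    The chord is exact at [delta] and [Delta], whence the equality case. *)

Definition concave_function (R : numFieldType) (D : set R) (f : R -> R) :
    Prop :=
  convex_function D (fun x : R => - f x).

Section ConvexPowers.
Variable R : realType.
Implicit Type p : R.

(* For [x > 0], [x `^ p] is the convex increasing [expR] composed with the
   function [p * ln x], which is convex because [p <= 0]. *)
Lemma convex_powR_le0 p : p <= 0 ->
  convex_function (`]0, +oo[%classic : set R) (@powR R ^~ p).
Proof.
move=> p_le0 t x y; rewrite !inE /= !in_itv /= !andbT => x_gt0 y_gt0.
have xy_gt0 := convR_gt0 t x_gt0 y_gt0.
have expR_conv := convex_expR t (p * ln x) (p * ln y).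
have p_ln_conv := ler_wnM2l p_le0 (concave_ln t x_gt0 y_gt0).
rewrite /powR !gt_eqF//; apply: le_trans expR_conv.
rewrite ler_expR; apply: le_trans p_ln_conv _.
by rewrite !convRE mulrDr ![p * (_ * _)]mulrCA.
Qed.

(* This is the convexity inequality for the exponent [p^-1 >= 1] at [x `^ p] and
   [y `^ p], raised to the power [p]. *)
Lemma concave_powR p : 0 <= p <= 1 ->
  concave_function (`[0, +oo[%classic : set R) (@powR R ^~ p).
Proof.
move=> /andP[]; rewrite le_eqVlt => /predU1P[<- _ t x y _ _|p_gt0 p_le1 t x y].
  by rewrite !powRr0 convmm.
rewrite !inE /= !in_itv /= !andbT => x_ge0 y_ge0.
have pV_ge1 : 1 <= p^-1 by rewrite invf_ge1.
have powRpK z : 0 <= z -> (z `^ p) `^ p^-1 = z.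
  by move=> z_ge0; rewrite -powRrM divff ?gt_eqF// powRr1.
have powRVK z : 0 <= z -> (z `^ p^-1) `^ p = z.
  by move=> z_ge0; rewrite -powRrM mulVf ?gt_eqF// powRr1.
have conv_ge0 (u v : R^o) : 0 <= u -> 0 <= v -> 0 <= conv t u v.
  by move=> u_ge0 v_ge0; rewrite convRE addr_ge0 ?mulr_ge0// subr_ge0 le1.
have := @convex_powR _ _ pV_ge1 t (x `^ p) (y `^ p).
rewrite !inE /= !in_itv /= !andbT !powRpK//.
move=> /(_ (powR_ge0 _ _) (powR_ge0 _ _)).
move=> /(ge0_ler_powR (ltW p_gt0) (powR_ge0 _ _) (conv_ge0 _ _ x_ge0 y_ge0)).
by rewrite powRVK ?conv_ge0 ?powR_ge0// -lerN2 convN.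
Qed.

End ConvexPowers.

Section Chord.
Variable R : numFieldType.
Implicit Types (f : R -> R) (a b x : R).

Definition chord f a b x : R := line_path (f a) (f b) (factor a b x).

Lemma chordE f a b x :
  chord f a b x = f a + (x - a) * ((f b - f a) / (b - a)).
Proof. by rewrite /chord line_pathEl /factor addrC -!mulrA [_^-1 * _]mulrC. Qed.

Lemma chord_left f a b : chord f a b a = f a.
Proof. by rewrite /chord factorl line_path0. Qed.

Lemma chord_right f a b : a != b -> chord f a b b = f b.
Proof. by move=> ab; rewrite /chord factorr// line_path1. Qed.

Lemma chordN f a b x : chord (fun y => - f y) a b x = - chord f a b x.
Proof. by rewrite !chordE; ring. Qed.

Lemma convex_le_chord (D : set R) f a b x : convex_function D f ->
  a \in D -> b \in D -> a <= x <= b -> f x <= chord f a b x.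
Proof.
move=> f_convex aD bD /andP[ax xb].
have [ab|ab] := eqVneq a b.
  by have -> : x = a; [apply/le_anti; rewrite ax ab xb | rewrite chord_left].
have ba_gt0 : 0 < b - a by rewrite subr_gt0 lt_neqAle ab (le_trans ax).
have fac_ge0 : 0 <= factor a b x by rewrite divr_ge0 ?subr_ge0 ?(le_trans ax).
have fac_le1 : factor a b x <= 1 by rewrite ler_pdivrMr// mul1r lerD2r.
have := f_convex (Itv01 fac_ge0 fac_le1) b a bD aD.
by rewrite [X in f X <= _ -> _]convR_line_path convR_line_path /= factorK.
Qed.

End Chord.

Section SumExcept.
Variables (R : numDomainType) (T : finType) (w : T).
Implicit Types f g : T -> R.

Lemma eq_sum_except f g : (forall u, u != w -> f u = g u) ->
  \sum_u f u = \sum_u g u + (f w - g w).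
Proof.
move=> fg; rewrite (bigD1 w)//= [in RHS](bigD1 w)//= [RHS]addrAC subrKC.
by rewrite (eq_bigr g).
Qed.

Lemma ler_sum_except f g : (forall u, u != w -> f u <= g u) ->
  \sum_u f u <= \sum_u g u + (f w - g w).
Proof.
move=> fg; rewrite (bigD1 w)//= [in leRHS](bigD1 w)//= addrAC subrKC lerD2l.
exact: ler_sum.
Qed.

End SumExcept.

Section ChordBound.
Variables (R : numFieldType) (T : finType) (x : T -> R) (a b : R).
Implicit Types (f : R -> R) (w : T).

Definition chord_bound f w : R :=
  \sum_u chord f a b (x u) + (f (x w) - chord f a b (x w)).

Lemma sum_chord f : \sum_u chord f a b (x u) =
  #|T|%:R * f a + (\sum_u x u - #|T|%:R * a) * ((f b - f a) / (b - a)).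
Proof.
under eq_bigr do rewrite chordE.
by rewrite big_split -mulr_suml sumrB !sumr_const /= !mulr_natl.
Qed.

Lemma chord_boundE f w : chord_bound f w =
  #|T|%:R * f a + (\sum_u x u - #|T|%:R * a) * ((f b - f a) / (b - a))
  + f (x w) - f a - (x w - a) * ((f b - f a) / (b - a)).
Proof. by rewrite /chord_bound sum_chord chordE opprD !addrA. Qed.

Lemma sum_eq_chord_bound f w : a != b ->
  (forall u, u != w -> x u = a \/ x u = b) ->
  \sum_u f (x u) = chord_bound f w.
Proof.
move=> ab x_ab; apply: eq_sum_except => u /x_ab[]->.
  by rewrite chord_left.
by rewrite chord_right.
Qed.

Hypothesis x_itv : forall u, a <= x u <= b.

Lemma convex_sum_le_chord_bound (D : set R) f w : convex_function D f ->
  a \in D -> b \in D -> \sum_u f (x u) <= chord_bound f w.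
Proof.
move=> f_convex aD bD.
by apply: ler_sum_except => u _; exact: convex_le_chord (x_itv u).
Qed.

Lemma concave_sum_ge_chord_bound (D : set R) f w :
  concave_function D f -> a \in D -> b \in D ->
  chord_bound f w <= \sum_u f (x u).
Proof.
move=> f_concave aD bD.
have := convex_sum_le_chord_bound w f_concave aD bD.
rewrite /chord_bound; under [X in _ <= X + _]eq_bigr do rewrite chordN.
by rewrite chordN !sumrN -!opprD lerN2.
Qed.

End ChordBound.

Section PowerChordBound.
Variables (R : realType) (T : finType) (x : T -> R) (a b p : R).
Hypothesis x_itv : forall u, a <= x u <= b.

Lemma sum_powR_le0_le_chord_bound w : 0 < a -> p <= 0 ->
  \sum_u x u `^ p <= chord_bound x a b (@powR R ^~ p) w.
Proof.
move=> a_gt0 p_le0; have /andP[ax xb] := x_itv w.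
by apply: convex_sum_le_chord_bound (convex_powR_le0 p_le0) _ _ => //;
  rewrite inE /= in_itv /= andbT// (lt_le_trans a_gt0)// (le_trans ax).
Qed.

Lemma sum_powR_ge1_le_chord_bound w : 0 <= a -> 1 <= p ->
  \sum_u x u `^ p <= chord_bound x a b (@powR R ^~ p) w.
Proof.
move=> a_ge0 p_ge1; have /andP[ax xb] := x_itv w.
by apply: convex_sum_le_chord_bound (convex_powR p_ge1) _ _ => //;
  rewrite inE /= in_itv /= andbT// (le_trans a_ge0)// (le_trans ax).
Qed.

Lemma sum_powR_ge_chord_bound w : 0 <= a -> 0 <= p <= 1 ->
  chord_bound x a b (@powR R ^~ p) w <= \sum_u x u `^ p.
Proof.
move=> a_ge0 p01; have /andP[ax xb] := x_itv w.
by apply: (concave_sum_ge_chord_bound x_itv w (concave_powR p01));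
  rewrite inE /= in_itv /= andbT// (le_trans a_ge0)// (le_trans ax).
Qed.

End PowerChordBound.

Section LevelCounting.
Variables (T : finType) (I : eqType) (d : T -> I).
Implicit Types (i j k : I) (s : seq I).
Local Open Scope nat_scope.

Definition level i : {set T} := [set u | d u == i].

Lemma sum_card_level s : uniq s ->
  \sum_(i <- s) #|level i| = #|[set u | d u \in s]|.
Proof.
move=> s_uniq; under eq_bigr do rewrite -sum1dep_card.
rewrite (exchange_big_dep predT)//= -sum1dep_card [RHS]big_mkcond.
apply: eq_bigr => u _; rewrite -big_filter sum1_size size_filter.
have -> : count (fun i => d u == i) s = count_mem (d u) s.
  by apply: eq_count => i; rewrite /= eq_sym.
by rewrite count_uniq_mem//; case: (_ \in s).
Qed.

Lemma mem_levels s u : uniq s -> #|T| <= \sum_(i <- s) #|level i| -> d u \in s.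
Proof.
move=> s_uniq; rewrite sum_card_level// -cardsT => T_le.
have /eqP/setP/(_ u) : [set v | d v \in s] == [set: T].
  by rewrite eqEcard finset.subsetT.
by rewrite !inE.
Qed.

Lemma two_levels_except i j k w : uniq [:: i; j; k] ->
  #|T| <= #|level i| + #|level j| + #|level k| ->
  #|level j| = 1 -> d w = j -> forall u, u != w -> d u = i \/ d u = k.
Proof.
move=> ijk_uniq T_le level_j1 dw u uw.
have /(mem_levels u ijk_uniq) : #|T| <= \sum_(h <- [:: i; j; k]) #|level h|.
  by rewrite !big_cons big_nil addn0 addnA.
rewrite !inE => /or3P[/eqP|/eqP duj|/eqP]; [by left | | by right].
have /card_le1_eqP level_j_le1 : #|level j| <= 1 by rewrite level_j1.
by move: uw; rewrite (level_j_le1 u w) ?eqxx// inE ?duj ?dw.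
Qed.

End LevelCounting.

Section ExcessCounting.
Variables (T : finType) (d : T -> nat) (a b k : nat).
Local Open Scope nat_scope.

Hypothesis a_le : forall u, a <= d u.
Hypothesis sum_d : \sum_u d u = #|T| * a + #|level d b| * (b - a) + k.

Lemma sum_excess_off_level : \sum_(u | d u != b) (d u - a) = k.
Proof.
have : \sum_u (d u - a) = #|level d b| * (b - a) + k.
  by rewrite sumnB// sum_d sum_nat_const -addnA addKn.
rewrite (bigID (fun u => d u == b)) /= (eq_bigr (fun=> b - a)).
  by rewrite sum_nat_cond_const => /addnI.
by move=> u /eqP ->.
Qed.

Lemma leq_off_level u : d u != b -> d u <= a + k.
Proof.
by move=> ub; rewrite -leq_subLR -sum_excess_off_level (bigD1 u)//= leq_addr.
Qed.

Lemma card_level_eq0 i : i != b -> a + k < i -> #|level d i| = 0.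
Proof.
move=> ib ki; apply/eqP; rewrite cards_eq0; apply: contraTT ki.
case/set0Pn => u; rewrite inE -leqNgt => /eqP du.
by rewrite -du leq_off_level ?du.
Qed.

(* Two vertices of level [a + k] would have total excess [2 * k > k]. *)
Lemma card_level_le1 : 0 < k -> a + k != b -> #|level d (a + k)| <= 1.
Proof.
move=> k_gt0 kb; apply/card_le1_eqP => u v; rewrite !inE => /eqP du /eqP dv.
apply: contraTeq k_gt0 => uv; rewrite -leqNgt -(leq_add2l k) addn0.
rewrite -[leqRHS]sum_excess_off_level (bigD1 u) ?du//= (bigD1 v) /=.
  by rewrite dv addKn addnA leq_addr.
by rewrite dv kb.
Qed.

End ExcessCounting.

Section NeighborhoodDegree.
Variable G : sgraph.
Local Open Scope nat_scope.

Lemma sum_ndeg : \sum_(u : G) ndeg u = first_Zagreb G.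
Proof.
rewrite /first_Zagreb /ndeg (exchange_big_dep predT)//=.
apply: eq_bigr => v _; rewrite sum_nat_const -mulnn; congr (_ * _).
by rewrite /deg cardsE; apply: eq_card => u; rewrite !unfold_in adj_sym.
Qed.

Lemma num_ndeg_neq0_exists i : num_ndeg G i <> 0 -> exists u : G, ndeg u = i.
Proof.
by move/eqP; rewrite cards_eq0 => /set0Pn[u]; rewrite inE => /eqP; exists u.
Qed.

Section ZagrebDecomposition.
Variable k : nat.

Hypothesis first_ZagrebE : first_Zagreb G =
  #|G| * min_ndeg G + num_ndeg G (max_ndeg G) * (max_ndeg G - min_ndeg G) + k.

Let sum_ndegE : \sum_(u : G) ndeg u = #|G| * min_ndeg G +
  #|level (@ndeg G) (max_ndeg G)| * (max_ndeg G - min_ndeg G) + k.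
Proof. by rewrite sum_ndeg first_ZagrebE. Qed.

Lemma ndeg_eq_min_or_max : k = 0 ->
  forall u : G, ndeg u = min_ndeg G \/ ndeg u = max_ndeg G.
Proof.
move=> k0 u; have [|u_lt_max] := eqVneq (ndeg u) (max_ndeg G); first by right.
left; apply/eqP; rewrite eqn_leq min_ndeg_le andbT.
by have := leq_off_level (@min_ndeg_le G) sum_ndegE u_lt_max; rewrite k0 addn0.
Qed.

Lemma num_ndeg_eq0 i : min_ndeg G + k < i < max_ndeg G -> num_ndeg G i = 0.
Proof.
case/andP=> k_lt i_lt.
by apply: (card_level_eq0 (@min_ndeg_le G) sum_ndegE _ k_lt); rewrite ltn_eqF.
Qed.

Lemma num_ndeg_le1 : 0 < k -> min_ndeg G + k < max_ndeg G ->
  num_ndeg G (min_ndeg G + k) <= 1.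
Proof.
move=> k_gt0 k_lt.
by apply: (card_level_le1 (@min_ndeg_le G) sum_ndegE k_gt0 _); rewrite ltn_eqF.
Qed.

End ZagrebDecomposition.

End NeighborhoodDegree.

Section ZagrebChordBound.
Variables (R : realType) (G : sgraph) (alpha : R).
Implicit Types (u w : G).
Local Notation delta := (min_ndeg G).
Local Notation Delta := (max_ndeg G).

Definition Zagreb_chord_bound w : R :=
  chord_bound (fun u : G => (ndeg u)%:R) delta%:R Delta%:R (@powR R ^~ alpha) w.

Lemma Zagreb_chord_boundE w k :
  let s := (Delta%:R `^ alpha - delta%:R `^ alpha) / (Delta%:R - delta%:R) in
  ndeg w = (delta + k)%N ->
  Zagreb_chord_bound w =
    #|G|%:R * delta%:R `^ alpha + ((first_Zagreb G)%:R - #|G|%:R * delta%:R) * s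
    + (delta + k)%:R `^ alpha - delta%:R `^ alpha - k%:R * s.
Proof.
move=> s dw; rewrite /Zagreb_chord_bound chord_boundE -natr_sum sum_ndeg dw.
have -> : (delta + k)%:R - delta%:R = k%:R :> R by rewrite natrD addrC addKr.
by [].
Qed.

Let ndeg_itv u : delta%:R <= ((ndeg u)%:R : R) <= Delta%:R.
Proof. by rewrite !ler_nat min_ndeg_le max_ndeg_ge. Qed.

Lemma gen_nbhd_Zagreb_le_chord_bound w :
  (alpha < 0 -> (0 < delta)%N) -> alpha < 0 \/ 1 < alpha ->
  gen_nbhd_Zagreb G alpha <= Zagreb_chord_bound w.
Proof.
move=> delta_gt0 [alpha_lt0|/ltW alpha_ge1].
  apply: sum_powR_le0_le_chord_bound (ltW alpha_lt0) => //.
  by rewrite ltr0n delta_gt0.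
exact: sum_powR_ge1_le_chord_bound.
Qed.

Lemma gen_nbhd_Zagreb_ge_chord_bound w : 0 <= alpha <= 1 ->
  Zagreb_chord_bound w <= gen_nbhd_Zagreb G alpha.
Proof. exact: sum_powR_ge_chord_bound. Qed.

Lemma gen_nbhd_Zagreb_eq_chord_bound w k : ndeg w = k ->
  (delta < k < Delta)%N -> num_ndeg G k = 1%N ->
  (#|G| <= num_ndeg G delta + num_ndeg G k + num_ndeg G Delta)%N ->
  gen_nbhd_Zagreb G alpha = Zagreb_chord_bound w.
Proof.
move=> dw k_itv k_once G_le.
have levels_uniq : uniq [:: delta; k; Delta] by rewrite /= !inE; lia.
have ndeg_ext := two_levels_except levels_uniq G_le k_once dw.
apply: sum_eq_chord_bound => [|u /ndeg_ext[]->]; [|by left|by right].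
by rewrite eqr_nat ltn_eqF//; lia.
Qed.

End ZagrebChordBound.

Theorem theorem3p5 (R : realType) (G : sgraph) (n m q r : nat) (alpha : R)
    (hn : #|G| = n) (hm : #|edges G| = m) (hn3 : (3 <= n)%N) :
  let delta := min_ndeg G in
  let Delta := max_ndeg G in
  let M1 := first_Zagreb G in
  let s := (Delta%:R `^ alpha - delta%:R `^ alpha) / (Delta%:R - delta%:R) in
  let bound := n%:R * delta%:R `^ alpha + (M1%:R - n%:R * delta%:R) * s
               + (delta + r)%:R `^ alpha - delta%:R `^ alpha - r%:R * s in
  let extremal := [/\ num_ndeg G Delta = q, num_ndeg G (delta + r) = 1%N
                    & num_ndeg G delta = (n - q - 1)%N] in
  (2 <= Delta - delta)%N ->
  M1%:Z - n%:Z * delta%:Z = q%:Z * (Delta%:Z - delta%:Z) + r%:Z ->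
  (0 < q)%N ->
  (r <= Delta - delta - 1)%N ->
  alpha != 0 -> alpha != 1 ->
  (alpha < 0 -> (1 <= delta)%N) ->
  [/\ r = 0%N -> num_ndeg G Delta = q ->
        forall u : G, ndeg u = delta \/ ndeg u = Delta,
      (1 <= r)%N -> num_ndeg G Delta = q ->
        (forall i : nat, (delta + r + 1 <= i <= Delta - 1)%N ->
           num_ndeg G i = 0%N)
        /\ (num_ndeg G (delta + r) <= 1)%N,
      (1 <= r)%N -> alpha < 0 \/ 1 < alpha -> num_ndeg G (delta + r) <> 0%N ->
        gen_nbhd_Zagreb G alpha <= bound
        /\ (extremal -> gen_nbhd_Zagreb G alpha = bound)
    & (1 <= r)%N -> 0 < alpha < 1 -> num_ndeg G (delta + r) <> 0%N ->
        bound <= gen_nbhd_Zagreb G alpha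
        /\ (extremal -> gen_nbhd_Zagreb G alpha = bound)].
Proof.
move=> delta Delta M1 s bound extremal range_ge2 M1E _ r_lt _ _ delta_gt0.
have M1_nat : num_ndeg G Delta = q ->
    M1 = (#|G| * delta + num_ndeg G Delta * (Delta - delta) + r)%N.
  by move=> ->; rewrite hn; nia.
have boundE (w : G) : ndeg w = (delta + r)%N ->
    Zagreb_chord_bound alpha w = bound.
  by move/(Zagreb_chord_boundE alpha); rewrite hn.
have extremalE (w : G) : ndeg w = (delta + r)%N -> (0 < r)%N -> extremal ->
    gen_nbhd_Zagreb G alpha = bound.
  move=> dw r_gt0 [nD nr nd]; rewrite -(boundE w dw).
  apply: (gen_nbhd_Zagreb_eq_chord_bound alpha dw _ nr); first lia.
  by rewrite hn nD nr nd; lia.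
split.
- by move=> r0 /M1_nat/ndeg_eq_min_or_max/(_ r0).
- move=> r_gt0 /M1_nat M1_split; split; last by apply: num_ndeg_le1 => //; lia.
  by move=> i i_itv; apply: (num_ndeg_eq0 M1_split); lia.
- move=> r_gt0 alpha_out /num_ndeg_neq0_exists[w dw].
  split; last exact: extremalE dw r_gt0.
  by rewrite -(boundE w dw); exact: gen_nbhd_Zagreb_le_chord_bound.
- move=> r_gt0 /andP[alpha_gt0 alpha_lt1] /num_ndeg_neq0_exists[w dw].
  split; last exact: extremalE dw r_gt0.
  rewrite -(boundE w dw); apply: gen_nbhd_Zagreb_ge_chord_bound.
  by rewrite !ltW.
Qed.
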